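(* For every $\delta\in[0,1)$ and every $\alpha\in(\delta/3,1/3)$ there exists $\epsilon>0$ with the following property. For all constants $0<c_1\le c_2$ there are $C>0$ and $n_0$ such that for all $n\ge n_0$, every prime $p$ with $c_1n^\alpha\le p\le c_2 n^\alpha$, every integer $\ell\le n+n^\delta$ and every $(\epsilon\log n)$-local function $f:\{0,1\}^\ell\to\{0,1\}^{n+1}$, $$\Delta\big(f(U),\,(X,\mathrm{majmod}_p(X)\oplus\mathrm{parity}(X))\big)\ \ge\ \tfrac12-\tfrac{C}{\log n},$$ where $U$ is uniform on $\{0,1\}^\ell$ and $X$ is uniform on $\{0,1\}^n$.
   Context: For $x\in\{0,1\}^k$ let $|x|=\sum_i x_i$ be its Hamming weight, $\mathrm{parity}(x)=|x|\bmod 2$, and for an odd prime $p$, $\mathrm{majmod}_p(x)=0$ if $(|x|\bmod p)<p/2$ and $\mathrm{majmod}_p(x)=1$ otherwise (here $a\bmod p\in\{0,\dots,p-1\}$). A function $f:\{0,1\}^\ell\to\{0,1\}^m$ is $d$-local if each output bit depends on at most $d$ input bits. For distributions $D_1,D_2$ on $\{0,1\}^m$, the total variation distance is $\Delta(D_1,D_2)=\max_{T\subseteq\{0,1\}^m}|\Pr[D_1\in T]-\Pr[D_2\in T]|$. $(X,g(X))$ denotes the distribution of the concatenation of $X$ with the bit $g(X)$. *)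

(* Defs.v *)
From HB Require Import structures.
From mathcomp Require Import all_boot all_order all_algebra.
From mathcomp Require Import reals exp.
Set Implicit Arguments. Unset Strict Implicit. Unset Printing Implicit Defensive.
Import Order.TTheory GRing.Theory Num.Theory.
Local Open Scope ring_scope.

Notation bits k := {ffun 'I_k -> bool}.

Definition hweight k (x : bits k) : nat := #|[set i | x i]|.
Definition parity k (x : bits k) : bool := odd (hweight x).
(* majmod_p(x) = 0 iff (|x| mod p) < p/2, i.e. 2*(|x| mod p) < p *)
Definition majmod (p : nat) k (x : bits k) : bool := ~~ ((hweight x %% p).*2 < p)%N.

Definition snoc_bit k (x : bits k) (b : bool) : bits k.+1 :=
  [ffun i => if unlift ord_max i is Some j then x j else b].

Definition target_map (p n : nat) (x : bits n) : bits n.+1 :=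
  snoc_bit x (majmod p x (+) parity x).

Definition push_prob (R : realType) (A B : finType) (g : A -> B) (T : {set B}) : R :=
  #|[set a | g a \in T]|%:R / #|A|%:R.

Definition tv_push (R : realType) (A1 A2 B : finType) (g1 : A1 -> B) (g2 : A2 -> B) : R :=
  \big[Num.max/0]_(T : {set B}) `|push_prob R g1 T - push_prob R g2 T|.

Definition is_local (R : realType) (l m : nat) (d : R) (f : bits l -> bits m) : Prop :=
  forall i : 'I_m, exists S : {set 'I_l}, #|S|%:R <= d /\
    forall x y : bits l, (forall j, j \in S -> x j = y j) -> f x i = f y i.

(* Main.v *)
(** If [l < n] the image of [f] is too small. Otherwise pick about [n / d^2] input bits [I] of
    degree at most [4d] whose output blocks are pairwise disjoint and which do not touch the
    last output bit. Once the other inputs are fixed, the weight of the output is a constant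
    plus a sum of independent two-valued terms, one for each [i] in [I].

    If many of these terms are non-constant, averaging the signed majority over them contracts
    its mean-zero part in L2([F_p]), since the shift by a nonzero residue satisfies a Poincare
    inequality with constant [O(p^2)]; the last output bit is then wrong with probability
    about 1/2. Otherwise, a block of the output that vanishes identically is either constant in
    its own input or has non-constant weight. By Chebyshev a uniform string has many vanishing
    blocks, so an output of this kind with as many vanishing blocks leaves many inputs without
    influence: it has so many preimages that such outputs form a negligible set. *)

Require Import Defs.
From HB Require Import structures.
From mathcomp Require Import all_boot all_order all_algebra.
From mathcomp Require Import ring lra zify.
From mathcomp Require Import reals sequences exp.
Set Implicit Arguments. Unset Strict Implicit. Unset Printing Implicit Defensive.
Import Order.TTheory GRing.Theory Num.Theory.
Local Open Scope ring_scope.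

(** * Averaging along shifts of [F_p] *)

Lemma sqr_sum_le (R : realFieldType) (k : nat) (a : nat -> R) :
  (\sum_(j < k) a j) ^+ 2 <= k%:R * \sum_(j < k) a j ^+ 2.
Proof.
elim: k => [|k IHk]; first by rewrite !big_ord0 expr0n mulr0.
rewrite !big_ord_recr /= -natr1.
set A := \sum_(j < k) a j in IHk *; set B := \sum_(j < k) a j ^+ 2 in IHk *.
have k0 : 0 <= k%:R :> R by [].
have AB : 2 * A * a k <= B + k%:R * a k ^+ 2.
  rewrite mulr_sumr mulr_suml.
  have -> : B + k%:R * a k ^+ 2 = \sum_(j < k) (a j ^+ 2 + a k ^+ 2).
    by rewrite big_split /= sumr_const card_ord mulr_natl.
  by apply: ler_sum => j _; have := sqr_ge0 (a j - a k); nra.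
nra.
Qed.

Section Mixing.
Variables (R : realType) (p : nat).
Hypothesis p_pr : prime p.

(** The sign [(-1) ^ e] records the change of parity when a weight moves by [e]; seen through
    [twist], this is the plain average with the translate by [e]. *)
Definition avg_shift (e : int) (m : 'F_p -> R) : 'F_p -> R :=
  fun v => (m v + (-1) ^ e * m (v + e%:~R)) / 2.

Lemma sum_shift (m : 'F_p -> R) (a : 'F_p) : \sum_v m (v + a) = \sum_v m v.
Proof. by rewrite [RHS](reindex_inj (addIr a)). Qed.

Lemma telescope_twisted (s : R) (m : 'F_p -> R) (a : 'F_p) (k : nat) (v : 'F_p) :
  m v - s ^+ k * m (v + k%:R * a) =
  \sum_(j < k) s ^+ j * (m (v + j%:R * a) - s * m (v + j%:R * a + a)).
Proof.
elim: k => [|k IHk]; first by rewrite big_ord0 mul0r addr0 expr0 mul1r subrr.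
rewrite big_ord_recr /= -IHk exprSr -natr1 mulrDl mul1r addrA; ring.
Qed.

(** Cauchy-Schwarz on the telescoping sum; after summing over [v], translation invariance makes its
    [k] terms equal. *)
Lemma sum_telescope_le (s : R) (m : 'F_p -> R) (a : 'F_p) (k : nat) :
  s ^+ 2 = 1 ->
  \sum_v (m v - s ^+ k * m (v + k%:R * a)) ^+ 2 <=
  k%:R ^+ 2 * \sum_v (m v - s * m (v + a)) ^+ 2.
Proof.
move=> s2.
have H v : (m v - s ^+ k * m (v + k%:R * a)) ^+ 2 <=
   k%:R * \sum_(j < k) (m (v + j%:R * a) - s * m (v + j%:R * a + a)) ^+ 2.
  rewrite telescope_twisted.
  apply: (le_trans (sqr_sum_le k
    (fun j => s ^+ j * (m (v + j%:R * a) - s * m (v + j%:R * a + a))))).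
  rewrite le_eqVlt; apply/orP; left; apply/eqP; congr (_ * _); apply: eq_bigr => j _.
  by rewrite exprMn -exprM mulnC exprM s2 expr1n mul1r.
apply: (le_trans (ler_sum _ (fun v _ => H v))).
rewrite -mulr_sumr exchange_big /= expr2 -mulrA ler_wpM2l //.
rewrite (eq_bigr (fun _ => \sum_v (m v - s * m (v + a)) ^+ 2)); last first.
  by move=> j _; rewrite (sum_shift (fun v => (m v - s * m (v + a)) ^+ 2)).
by rewrite sumr_const card_ord mulr_natl.
Qed.

(* Average over [k] of the L2 distance between [m] and its shift by [k * a], which is at most
   [k] times the one for [k = 1]. *)
Lemma poincare_even (m : 'F_p -> R) (a : 'F_p) :
  a != 0 -> \sum_v m v = 0 ->
  2 * \sum_v m v ^+ 2 <= p%:R ^+ 2 * \sum_v (m v - m (v + a)) ^+ 2.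
Proof.
move=> a0 m0; set E := \sum_v (m v - m (v + a)) ^+ 2.
have p0 : 0 < p%:R :> R by rewrite ltr0n prime_gt0.
have E0 : 0 <= E by apply: sumr_ge0 => v _; apply: sqr_ge0.
have H (k : 'F_p) : \sum_v (m v - m (v + k * a)) ^+ 2 <= p%:R ^+ 2 * E.
  have kp : (val k < p)%N by have := ltn_ord k; rewrite [X in (_ < X)%N -> _]Fp_cast.
  have := @sum_telescope_le 1 m a (val k) (expr1n _ _).
  rewrite expr1n; under eq_bigr do rewrite mul1r natr_Zp.
  under [X in _ <= _ * X]eq_bigr do rewrite mul1r.
  move=> /le_trans; apply; rewrite ler_wpM2r // lerXn2r ?nnegrE ?ler0n //.
  by rewrite ler_nat ltnW.
have := ler_sum (P := predT) (index_enum _) (fun k _ => H k).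
rewrite sumr_const card_Fp // exchange_big /=.
have -> : \sum_v \sum_k (m v - m (v + k * a)) ^+ 2 = p%:R * (2 * \sum_v m v ^+ 2).
  transitivity (\sum_v (p%:R * m v ^+ 2 + \sum_w m w ^+ 2)); last first.
    rewrite big_split /= -mulr_sumr sumr_const card_Fp // -mulr_natl; ring.
  apply: eq_bigr => v _.
  have re (g : 'F_p -> R) : \sum_k g (v + k * a) = \sum_w g w.
    by rewrite [RHS](reindex_inj (addrI v)) /= [RHS](reindex_inj (mulIf a0)).
  transitivity (\sum_k (m v ^+ 2 - 2 * m v * m (v + k * a) + m (v + k * a) ^+ 2)).
    by apply: eq_bigr => k _; ring.
  rewrite !big_split /= sumr_const card_Fp // sumrN -mulr_sumr (re m).
  by rewrite (re (fun w => m w ^+ 2)) m0 -[m v ^+ 2 *+ p]mulr_natl mulr0 subr0.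
by rewrite -[(_ * E) *+ p]mulr_natl ler_pM2l.
Qed.

(* Going once around the odd cycle generated by [a] turns [m v] into [- m v]. *)
Lemma poincare_odd (m : 'F_p -> R) (a : 'F_p) :
  odd p -> 4 * \sum_v m v ^+ 2 <= p%:R ^+ 2 * \sum_v (m v + m (v + a)) ^+ 2.
Proof.
move=> p_odd.
have s2 : (-1 : R) ^+ 2 = 1 by rewrite sqrrN expr1n.
have := sum_telescope_le m a p s2.
rewrite -signr_odd p_odd expr1 pchar_Fp_0 //.
under eq_bigr => v _ do
  rewrite mulN1r opprK mul0r addr0 -mulr2n -mulr_natl exprMn -natrX.
under [X in _ <= _ * X]eq_bigr do rewrite mulN1r opprK.
by rewrite -mulr_sumr.
Qed.

(** Expanding the square leaves [S - E / 4], where [E] is the energy of the twisted difference. The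
    Poincare inequality for the parity of [e] bounds [E] below by [2 * S / p ^ 2]. *)
Lemma avg_shift_sqr_le (e : int) (m : 'F_p -> R) :
  odd p -> \sum_v m v = 0 -> e%:~R != 0 :> 'F_p ->
  \sum_v avg_shift e m v ^+ 2 <= (1 - (2 * p%:R ^+ 2)^-1) * \sum_v m v ^+ 2.
Proof.
move=> p_odd m0 e0.
have p0 : 0 < p%:R ^+ 2 :> R by rewrite exprn_gt0 // ltr0n prime_gt0.
pose s : R := (-1) ^ e; pose S := \sum_v m v ^+ 2.
pose E := \sum_v (m v - s * m (v + e%:~R)) ^+ 2.
have sE : s = 1 \/ s = -1.
  by rewrite /s expN1r -signr_odd; case: odd; [right|left].
have s2 : s ^+ 2 = 1 by case: sE => ->; rewrite ?sqrrN expr1n.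
have SE : 2 * S <= p%:R ^+ 2 * E.
  case: sE => sE; rewrite /E sE.
    by under eq_bigr do rewrite mul1r; exact: poincare_even.
  under eq_bigr do rewrite mulN1r opprK.
  apply: le_trans (poincare_odd _ _ p_odd); rewrite ler_wpM2r //; last lra.
  by apply: sumr_ge0 => v _; apply: sqr_ge0.
have -> : \sum_v avg_shift e m v ^+ 2 = S - E / 4.
  have -> : S = \sum_v (m v ^+ 2 + m (v + e%:~R) ^+ 2) / 2.
    by rewrite -mulr_suml big_split /= (sum_shift (fun v => m v ^+ 2)) /S; field.
  rewrite /E mulr_suml -sumrB; apply: eq_bigr => v _.
  rewrite /avg_shift -/s.
  set x := m v; set y := m _.
  have -> : y ^+ 2 = s ^+ 2 * y ^+ 2 by rewrite s2 mul1r.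
  by field.
rewrite mulrBl mul1r lerD2l lerN2 invfM.
rewrite -/S; set P : R := p%:R ^+ 2 in p0 SE *.
rewrite -mulrA ler_pdivrMl // ler_pdivrMl //; lra.
Qed.

Definition avg_shifts (m : 'F_p -> R) (es : seq int) : 'F_p -> R :=
  foldr avg_shift m es.

Lemma sum_avg_shift (e : int) (m : 'F_p -> R) :
  \sum_v m v = 0 -> \sum_v avg_shift e m v = 0.
Proof.
by move=> m0; rewrite -mulr_suml big_split /= -mulr_sumr sum_shift m0 mulr0 addr0 mul0r.
Qed.

Lemma sum_avg_shifts (es : seq int) (m : 'F_p -> R) :
  \sum_v m v = 0 -> \sum_v avg_shifts m es v = 0.
Proof. by move=> m0; elim: es => //= e es; exact: sum_avg_shift. Qed.

(** Constants need not contract: an even shift keeps them and an odd one kills them, so they must be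
    split off. *)
Lemma avg_shifts_addC (c : R) (m m0 : 'F_p -> R) (es : seq int) :
  (forall v, m v = c + m0 v) ->
  exists2 t, `|t| <= 1 & forall v, avg_shifts m es v = t * c + avg_shifts m0 es v.
Proof.
move=> mE; elim: es => [|e es [t t1 IH]] /=.
  by exists 1 => [|v]; rewrite ?normr1 // mul1r.
exists ((t + (-1) ^ e * t) / 2); last first.
  by move=> v; rewrite /avg_shift !IH; field.
rewrite normrM normfV (normr_nat _ 2) ler_pdivrMr // mul1r.
apply: (le_trans (ler_normD _ _)); rewrite normrM expN1r normrX normrN1 expr1n.
lra.
Qed.

Definition contraction : R := 1 - (2 * p%:R ^+ 2)^-1.

Lemma contraction_ge0 : 0 <= contraction.
Proof.
have p1 : 1 <= p%:R :> R by rewrite ler1n prime_gt0.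
rewrite subr_ge0 invf_le1; nra.
Qed.

Lemma avg_shifts_sqr_le (m : 'F_p -> R) (es : seq int) :
  odd p -> \sum_v m v = 0 ->
  {in es, forall e, e != 0 -> e%:~R != 0 :> 'F_p} ->
  \sum_v avg_shifts m es v ^+ 2 <=
  contraction ^+ count (fun e => e != 0) es * \sum_v m v ^+ 2.
Proof.
move=> p_odd m0; elim: es => [|e es IH] es_p /=; first by rewrite expr0 mul1r.
have {}IH := IH (sub_in1 (mem_behead (s := e :: es)) es_p).
have [->|e0] := eqVneq e 0.
  rewrite add0n; apply: le_trans IH; rewrite le_eqVlt; apply/orP; left; apply/eqP.
  by apply: eq_bigr => v _; rewrite /avg_shift mulr0z addr0 expr0z mul1r; congr (_ ^+ 2); field.
have e1 : e%:~R != 0 :> 'F_p by apply: es_p => //; rewrite mem_head.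
apply: (le_trans (avg_shift_sqr_le p_odd (sum_avg_shifts es m0) e1)).
by rewrite add1n (exprS contraction) -mulrA ler_wpM2l // contraction_ge0.
Qed.

(** The mean of [m] is at most [1 / p] in absolute value and does not grow. The mean-zero part is
    bounded pointwise by its L2 norm, which contracts at each nonzero shift. *)
Lemma avg_shifts_bound (m : 'F_p -> R) (es : seq int) (N : nat) (eta : R) (v : 'F_p) :
  odd p -> (forall w, m w ^+ 2 = 1) -> `|\sum_w m w| <= 1 ->
  {in es, forall e, e != 0 -> e%:~R != 0 :> 'F_p} ->
  (N <= count (fun e => e != 0%R) es)%N ->
  0 <= eta -> contraction ^+ N * p%:R <= eta ^+ 2 ->
  `|avg_shifts m es v| <= p%:R^-1 + eta.
Proof.
move=> p_odd m1 sm es_p Nes eta0 eta_p.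
have p0 : 0 < p%:R :> R by rewrite ltr0n prime_gt0.
have pn0 : p%:R != 0 :> R by rewrite gt_eqF.
pose c := (\sum_w m w) / p%:R; pose m0 w := m w - c.
have [t t1 ->] := @avg_shifts_addC c m m0 es (fun w => esym (subrKC c (m w))).
apply: (le_trans (ler_normD _ _)); apply: lerD.
  rewrite normrM -[leRHS]mul1r; apply: ler_pM => //.
  by rewrite normrM normfV (normr_nat _ p) ler_piMl // invr_ge0 ltW.
have sm0 : \sum_w m0 w = 0.
  by rewrite sumrB sumr_const card_Fp // -mulr_natr divfK // subrr.
have sm0_2 : \sum_w m0 w ^+ 2 <= p%:R.
  have -> : \sum_w m0 w ^+ 2 = \sum_w (1 - c ^+ 2 - 2 * c * m0 w).
    by apply: eq_bigr => w _; rewrite -[X in X - c ^+ 2](m1 w) /m0; ring.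
  rewrite sumrB -mulr_sumr sm0 mulr0 subr0 sumr_const card_Fp //.
  rewrite -[(1 - _) *+ p]mulr_natr.
  by rewrite ler_piMl ?ler0n // gerBl sqr_ge0.
rewrite -(@ler_pXn2r _ 2) ?nnegrE // real_normK ?num_real //.
apply: le_trans eta_p.
apply: (@le_trans _ _ (\sum_w avg_shifts m0 es w ^+ 2)).
  by rewrite (bigD1 v) //= lerDl sumr_ge0 // => w _; apply: sqr_ge0.
apply: (le_trans (avg_shifts_sqr_le p_odd sm0 es_p)).
apply: ler_pM => //; first by rewrite exprn_ge0 // contraction_ge0.
  by rewrite sumr_ge0 // => w _; apply: sqr_ge0.
apply: ler_wiXn2l => //; first exact: contraction_ge0.
by rewrite gerBl invr_ge0 mulr_ge0 // sqr_ge0.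
Qed.

(* On weights, majmod + parity becomes the function [majmod_sign] of [F_p] twisted by the
   parity sign, so that one works modulo [p] rather than modulo [2p]. *)
Definition twist (m : 'F_p -> R) (w : int) : R := (-1) ^ w * m w%:~R.

Lemma twist_avg_shift (e : int) (m : 'F_p -> R) (w : int) :
  twist (avg_shift e m) w = (twist m w + twist m (w + e)) / 2.
Proof.
by rewrite /twist /avg_shift expfzDr ?oppr_eq0 ?oner_eq0 // rmorphD /=; field.
Qed.

Lemma norm_twist (m : 'F_p -> R) (w : int) : `|twist m w| = `|m w%:~R|.
Proof. by rewrite normrM expN1r normrX normrN1 expr1n mul1r. Qed.

Section Involutions.
Variables (U : finType) (I : eqType) (tau : I -> U -> U) (W : U -> int) (c : U -> R).
Hypothesis tauK : forall i, involutive (tau i).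

Definition increment (i : I) (u : U) : int := W (tau i u) - W u.

(** Pairing [u] with [tau i u] replaces the summand by its average over the pair. The weight [c] and
    the other increments agree on the pair, so the involutions can be treated one at a time. *)
Lemma sum_avg_increments (m : 'F_p -> R) (s : seq I) : uniq s ->
  {in s, forall i u, c (tau i u) = c u} ->
  {in s &, forall i j, i != j -> forall u, increment j (tau i u) = increment j u} ->
  \sum_u c u * twist m (W u) =
  \sum_u c u * twist (avg_shifts m [seq increment i u | i <- s]) (W u).
Proof.
elim: s => [|i s IH] //= /andP[i_s us] cs incs.
rewrite IH //; last 2 first.
- by move=> j js u; apply: cs; rewrite inE js orbT.
- by move=> j k js ks; apply: incs; rewrite inE (js, ks) orbT.
pose h u := c u * twist (avg_shifts m [seq increment j u | j <- s]) (W u).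
rewrite -/(\sum_u h u).
have hi : \sum_u h (tau i u) = \sum_u h u.
  by rewrite [RHS](reindex_inj (inv_inj (tauK i))).
rewrite [LHS](_ : _ = (\sum_u h u + \sum_u h (tau i u)) / 2); last first.
  by rewrite hi; field.
rewrite -big_split /= mulr_suml; apply: eq_bigr => u _.
rewrite twist_avg_shift /h cs ?mem_head //.
have -> : [seq increment j (tau i u) | j <- s] = [seq increment j u | j <- s].
  apply/eq_in_map => j js; apply: incs; rewrite ?mem_head ?inE ?js ?orbT //.
  by apply: contraNneq i_s => ->.
by rewrite {2}/increment subrKC; ring.
Qed.

End Involutions.

End Mixing.

(** * The majority sign on residues *)

Definition majmod_sign (R : realType) (p : nat) (v : 'F_p) : R :=
  (-1) ^+ ~~ ((v : nat).*2 < p)%N.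
Arguments majmod_sign R p v : clear implicits.

Lemma twist_majmod_sign (R : realType) (p k : nat) (x : bits k) : prime p ->
  twist (majmod_sign R p) (hweight x) = (-1) ^+ (majmod p x (+) parity x).
Proof.
move=> p_pr; rewrite /twist /majmod_sign /majmod /parity -?pmulrn val_Fp_nat //.
by rewrite expN1r /= -signr_odd -signr_addb addbC.
Qed.

(** As [p] is odd, negation swaps the two halves of the nonzero residues, so only the residue 0
    contributes. *)
Lemma norm_sum_majmod_sign (R : realType) (p : nat) : prime p -> odd p ->
  `|\sum_v majmod_sign R p v| <= 1.
Proof.
move=> p_pr p_odd; rewrite (bigD1 0) //=.
set s := \sum_(v | _) _; have -> : s = 0.
  suff: s = - s by lra.
  rewrite {1}/s (reindex_inj (@oppr_inj 'F_p)) /= -sumrN; apply: eq_big => v.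
    by rewrite oppr_eq0.
  rewrite oppr_eq0 => v0; rewrite /majmod_sign.
  have vp : (v < p)%N by have := ltn_ord v; rewrite [X in (_ < X)%N -> _]Fp_cast.
  have v1 : (0 < v)%N by rewrite lt0n; apply: contra v0.
  have -> : (- v : 'F_p) = (p - v)%N :> nat.
    rewrite /= [X in (_ %% X)%N]Fp_cast // [X in (X - _)%N]Fp_cast // modn_small //; lia.
  rewrite -signrN negbK; congr (_ ^+ _); lia.
by rewrite addr0 /majmod_sign normr_sign.
Qed.

(** * Vanishing blocks of a uniform string *)

Section ZeroBlocks.
Variables (R : realType) (n : nat) (T : finType) (I : {set T}) (B : T -> {set 'I_n}).
Hypothesis B_disj : {in I &, forall i k, i != k -> [disjoint B i & B k]}.

Definition vanishes (C : {set 'I_n}) (x : bits n) : bool := [forall j in C, ~~ x j].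

Definition zero_blocks (x : bits n) : {set T} := [set i in I | vanishes (B i) x].

Lemma card_vanishes (C : {set 'I_n}) :
  \sum_x (vanishes C x)%:R = 2 ^+ n * 2 ^- #|C| :> R.
Proof.
rewrite -natr_sum -big_mkcond sum1_card /=.
have -> : #|[pred x | vanishes C x]| = #|pffun_on false (mem (~: C)) (mem predT) : {pred bits n}|.
  apply: eq_card => x; rewrite !inE; apply/forall_inP/pffun_onP => [h|[h _] j jC].
    split=> //; apply/subsetP => j; rewrite !inE; apply: contra => jC.
    by rewrite eqbF_neg h.
  apply/negP => xj; have /(subsetP h) : j \in false.-support x by rewrite inE xj.
  by rewrite inE jC.
rewrite card_pffun_on card_bool natrX.
rewrite -[X in 2 ^+ X * _](card_ord n) -(cardsC C) exprD mulrAC divff ?mul1r //.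
by rewrite expf_neq0 ?pnatr_eq0.
Qed.

Lemma vanishes_setU (C1 C2 : {set 'I_n}) (x : bits n) :
  vanishes (C1 :|: C2) x = vanishes C1 x && vanishes C2 x.
Proof.
apply/forall_inP/andP => [h|[/forall_inP h1 /forall_inP h2] j].
  by split; apply/forall_inP => j jC; apply: h; rewrite inE jC ?orbT.
by rewrite inE => /orP[/h1|/h2].
Qed.

Let q i : R := 2 ^- #|B i|.
Let E := \sum_(i in I) q i.

(** This is a variance, scaled by [2 ^ n]: disjoint blocks have uncorrelated indicators, and each
    indicator has variance [q i - q i ^ 2]. *)
Lemma sum_zero_blocks_sqr :
  \sum_x (#|zero_blocks x|%:R - E) ^+ 2 <= 2 ^+ n * E.
Proof.
pose a i x : R := (vanishes (B i) x)%:R.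
have zE x : #|zero_blocks x|%:R - E = \sum_(i in I) (a i x - q i).
  rewrite sumrB; congr (_ - _); rewrite -sum1_card natr_sum.
  rewrite big_mkcond [RHS]big_mkcond /=; apply: eq_bigr => i _.
  by rewrite inE /a; case: (i \in I); case: vanishes.
have q0 i : 0 <= q i by rewrite invr_ge0 exprn_ge0.
have cov i k : i \in I -> k \in I ->
    \sum_x (a i x - q i) * (a k x - q k) = if k == i then 2 ^+ n * (q i - q i ^+ 2) else 0.
  move=> iI kI.
  have ik : \sum_x a i x * a k x = 2 ^+ n * (if k == i then q i else q i * q k).
    transitivity (\sum_x (vanishes (B i :|: B k) x)%:R : R).
      by apply: eq_bigr => x _; rewrite /a vanishes_setU -natrM mulnb.
    rewrite card_vanishes; have [->|ki] := eqVneq k i; first by rewrite setUid.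
    have disj : [disjoint B i & B k] by apply: B_disj; rewrite // eq_sym.
    have := leq_card_setU (B i) (B k); rewrite disj => -[_ /eqP ->].
    by rewrite exprD invfM.
  transitivity (\sum_x (a i x * a k x - q k * a i x - q i * a k x + q i * q k)).
    by apply: eq_bigr => x _; ring.
  rewrite big_split /= !sumrB -!mulr_sumr ik !card_vanishes sumr_const.
  rewrite card_ffun card_bool card_ord -[_ *+ (2 ^ n)]mulr_natl natrX -/(q i) -/(q k).
  by case: eqVneq => [->|_]; ring.
have -> : \sum_x (#|zero_blocks x|%:R - E) ^+ 2 =
    \sum_x \sum_(i in I) \sum_(k in I) (a i x - q i) * (a k x - q k).
  by apply: eq_bigr => x _; rewrite zE expr2 mulr_suml; apply: eq_bigr => i _; rewrite mulr_sumr.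
rewrite exchange_big /= mulr_sumr; apply: ler_sum => i iI.
rewrite exchange_big /= (eq_bigr _ (fun k kI => cov i k iI kI)).
rewrite -big_mkcondr /= (big_pred1 i); last first.
  by move=> k /=; rewrite andb_idl // => /eqP ->.
by rewrite ler_wpM2l ?exprn_ge0 // gerBl sqr_ge0.
Qed.

(** Chebyshev: fewer than [K] vanishing blocks means a deviation of at least [E / 2] from the mean
    [E]. *)
Lemma card_few_zero_blocks (K : nat) : (0 < K)%N -> K.*2%:R <= E ->
  #|[set x | #|zero_blocks x| < K]%N|%:R <= 2 ^+ n * (2 / K%:R) :> R.
Proof.
move=> K0; rewrite -muln2 natrM => KE.
have K1 : 0 < K%:R :> R by rewrite ltr0n.
have E0 : 0 < E by lra.
set A := [set x | _].
have : #|A|%:R * (E ^+ 2 / 4) <= 2 ^+ n * E.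
  apply: le_trans sum_zero_blocks_sqr.
  rewrite mulr_natl -sumr_const big_mkcond /=; apply: ler_sum => x _.
  case: ifP => [|_]; last exact: sqr_ge0.
  rewrite inE -(ltr_nat R) => xK; nra.
have -> : 2 ^+ n * E = (2 ^+ n * (4 / E)) * (E ^+ 2 / 4) by field; lra.
rewrite ler_pM2r; last by rewrite divr_gt0 ?exprn_gt0.
move=> /le_trans; apply; rewrite ler_wpM2l ?exprn_ge0 //.
rewrite ler_pdivrMr // mulrAC ler_pdivlMr //; lra.
Qed.

End ZeroBlocks.

(** * Local maps *)

(** Take a maximal set of low-degree inputs, no two read by the same output bit. Every other
    admissible input shares an output bit with a member, and a member has at most [4 * d * d] such
    neighbours. *)
Lemma exists_independent_inputs (l n d : nat) (S : 'I_n.+1 -> {set 'I_l}) :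
  (forall j, #|S j| <= d)%N -> (0 < d)%N ->
  exists I : {set 'I_l},
    [/\ {in I, forall i, i \notin S ord_max},
        forall j, {in I &, forall i k, i \in S j -> k \in S j -> i = k},
        {in I, forall i, #|[set j | i \in S j]| <= 4 * d}%N
      & (4 * l <= n.+1 + 4 * d + 4 * (#|I| * (4 * d ^ 2 + 1)))%N].
Proof.
move=> Sd d0; pose deg i := #|[set j | i \in S j]|.
have degE i : deg i = (\sum_j (i \in S j))%N by rewrite /deg -sum1dep_card big_mkcond.
have SE (A : {set 'I_l}) : #|A| = (\sum_i (i \in A))%N by rewrite -sum1_card big_mkcond.
pose bad := [set i | 4 * d < deg i]%N.
(* Markov: the degrees sum to at most [d * n.+1], and each bad input takes more than [4 * d] of
   it. *)
have bad_le : (4 * #|bad| <= n.+1)%N.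
  rewrite -(leq_pmul2r d0).
  apply: (@leq_trans (\sum_i deg i)%N).
    apply: (@leq_trans (\sum_(i in bad) deg i)%N); last first.
      by rewrite [X in (_ <= X)%N](bigID (mem bad)) /= leq_addr.
    rewrite mulnAC mulnC -sum_nat_const; apply: leq_sum => i; rewrite inE; exact: ltnW.
  under eq_bigr do rewrite degE; rewrite exchange_big /=.
  under eq_bigr do rewrite -SE; rewrite -[X in (_ <= X * _)%N]card_ord -sum_nat_const.
  exact: leq_sum.
pose G := ~: (bad :|: S ord_max).
pose P (A : {set 'I_l}) := (A \subset G) && [forall j, #|A :&: S j| <= 1]%N.
have P0 : P set0.
  by rewrite /P sub0set; apply/forallP => j; rewrite set0I cards0.
have [I /maxsetP[/andP[IG /forallP I1] Imax] _] := maxset_exists P0.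
have IGP i : i \in I -> (deg i <= 4 * d)%N /\ i \notin S ord_max.
  by move=> /(subsetP IG); rewrite !inE negb_or -leqNgt => /andP[].
exists I; split.
- by move=> i /IGP[].
- by move=> j i k iI kI ij kj; apply: (card_le1_eqP (I1 j)); rewrite inE ?iI ?kI.
- by move=> i /IGP[].
have GI : (#|G :\: I| <= #|I| * (4 * d ^ 2))%N.
  (* By maximality [i] cannot join [I], so some output bit [j] reads both [i] and a member [k]. *)
  have H i : i \in G :\: I -> (1 <= \sum_(k in I) \sum_j (k \in S j) * (i \in S j))%N.
    rewrite inE => /andP[iI iG].
    have : ~~ P (i |: I).
      apply: contra iI => PiI; rewrite -(Imax _ PiI) ?setU11 //; exact: subsetUr.
    rewrite negb_and subUset sub1set iG IG /= negb_forall => /existsP[j].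
    rewrite -ltnNge => card_gt1.
    have ij : i \in S j.
      apply: contraLR card_gt1 => ij; rewrite -leqNgt; apply: leq_trans (I1 j).
      apply/subset_leq_card/subsetP => k; rewrite !inE => /andP[/orP[/eqP ->|->]] //.
      by rewrite (negPf ij).
    have [k] : exists k, k \in I :&: S j.
      apply/set0Pn; apply: contraTneq card_gt1 => I0.
      by rewrite setIUl I0 setU0 -leqNgt -(cards1 i) subset_leq_card ?subsetIl.
    rewrite inE => /andP[kI kj].
    by rewrite (bigD1 k) //= (bigD1 j) //= ij kj.
  rewrite -sum1_card; apply: leq_trans (leq_sum _ H) _.
  rewrite exchange_big /= -sum_nat_const; apply: leq_sum => k /IGP[kd _].
  rewrite exchange_big /=.
  apply: (@leq_trans (\sum_j (k \in S j) * d)%N).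
    apply: leq_sum => j _; rewrite -big_distrr /= leq_mul2l; apply/orP; right.
    apply: leq_trans (Sd j); rewrite SE [X in (_ <= X)%N](bigID (mem (G :\: I))) /=.
    exact: leq_addr.
  by rewrite -big_distrl /= -degE expnS expn1 mulnA leq_mul2r kd orbT.
have lE : (l <= #|bad| + d + #|G|)%N.
  rewrite -[X in (X <= _)%N](card_ord l) -(cardsC G) addnC leq_add2r setCK.
  apply: leq_trans (leq_card_setU _ _) _; by rewrite leq_add2l.
have GE : #|G| = (#|I| + #|G :\: I|)%N.
  by rewrite -[LHS](cardsID I) (setIidPr IG).
lia.
Qed.

Definition init_bits (k : nat) (z : bits k.+1) : bits k := [ffun j => z (lift ord_max j)].

Lemma init_snoc_bit (k : nat) (x : bits k) (b : bool) : init_bits (snoc_bit x b) = x.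
Proof. by apply/ffunP => j; rewrite !ffunE liftK. Qed.

Lemma snoc_bit_last (k : nat) (x : bits k) (b : bool) : snoc_bit x b ord_max = b.
Proof. by rewrite ffunE unlift_none. Qed.

Lemma hweight_sum (k : nat) (x : bits k) : hweight x = \sum_j (x j)%:R :> int.
Proof. by rewrite /hweight -sum1dep_card big_mkcond /= -natr_sum natz. Qed.

Definition flips (l : nat) (A : {set 'I_l}) (u : bits l) : bits l :=
  [ffun j => u j (+) (j \in A)].

Lemma flipsK (l : nat) (A : {set 'I_l}) : involutive (flips A).
Proof. by move=> u; apply/ffunP => j; rewrite !ffunE addbK. Qed.

Lemma flips_inj (l : nat) (u : bits l) : injective (fun A => flips A u).
Proof.
by move=> A B /ffunP AB; apply/setP => j; have := AB j; rewrite !ffunE => /addbI.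
Qed.

(** * Flipping independent inputs of a local map *)

Section LocalMap.
Variables (R : realType) (l n d p N K : nat) (f : bits l -> bits n.+1).
Variables (S : 'I_n.+1 -> {set 'I_l}) (I : {set 'I_l}) (eta : R).
Hypothesis f_local : forall j (x y : bits l), (forall i, i \in S j -> x i = y i) -> f x j = f y j.
Hypothesis I_last : {in I, forall i, i \notin S ord_max}.
Hypothesis I_disj : forall j, {in I &, forall i k, i \in S j -> k \in S j -> i = k}.
Hypothesis I_deg : {in I, forall i, #|[set j | i \in S j]| <= d}%N.
Hypotheses (p_pr : prime p) (p_odd : odd p) (d_lt_p : (d < p)%N).
Hypotheses (eta_ge0 : 0 <= eta) (eta_p : contraction R p ^+ N * p%:R <= eta ^+ 2).

Let flip i := @flips l [set i].

Lemma local_flip (i : 'I_l) (u : bits l) (j : 'I_n.+1) :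
  i \notin S j -> f (flip i u) j = f u j.
Proof.
move=> ij; apply: f_local => k kj; rewrite ffunE inE.
by case: eqP => [ki|_]; rewrite ?addbF //; rewrite -ki kj in ij.
Qed.

Definition block (i : 'I_l) : {set 'I_n} := [set j | i \in S (lift ord_max j)].

Lemma card_block_le i : i \in I -> (#|block i| <= d)%N.
Proof.
move=> /I_deg; apply: leq_trans; rewrite -(card_imset _ (@lift_inj _ ord_max)).
by apply/subset_leq_card/subsetP => _ /imsetP[j + ->]; rewrite !inE.
Qed.

Lemma block_disj : {in I &, forall i k, i != k -> [disjoint block i & block k]}.
Proof.
move=> i k iI kI; apply: contraNT => /pred0Pn[j /=]; rewrite !inE => /andP[ij kj].
by apply/eqP; exact: I_disj ij kj.
Qed.

Definition weight (u : bits l) : int := hweight (init_bits (f u)).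

Let inc := increment flip weight.

Lemma incE i u :
  inc i u = \sum_(j in block i)
    ((f (flip i u) (lift ord_max j))%:R - (f u (lift ord_max j))%:R).
Proof.
rewrite /inc /increment /weight !hweight_sum -sumrB (bigID (mem (block i))) /=.
rewrite [X in _ + X]big1 ?addr0; last first.
  by move=> j; rewrite inE => ij; rewrite !ffunE local_flip ?subrr.
by apply: eq_bigr => j _; rewrite !ffunE.
Qed.

(** No output bit reads both [i] and [k], so flipping [i] leaves the block of [k] alone. *)
Lemma inc_flip_neq i k : i \in I -> k \in I -> i != k ->
  forall u, inc k (flip i u) = inc k u.
Proof.
move=> iI kI ik u; rewrite !incE; apply: eq_bigr => j; rewrite inE => kj.
have ij : i \notin S (lift ord_max j).
  by apply: contra ik => ij; apply/eqP; exact: I_disj ij kj.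
rewrite (local_flip _ ij); congr (_%:R - _).
rewrite -[in RHS](local_flip _ ij); congr (nat_of_bool (f _ _)).
by apply/ffunP => a; rewrite !ffunE addbAC.
Qed.

Lemma inc_flip_same i u : inc i (flip i u) = - inc i u.
Proof. by rewrite /inc /increment /flip flipsK opprB. Qed.

Lemma inc_le i u : i \in I -> (`|inc i u| <= d)%N.
Proof.
move=> iI; apply: leq_trans (card_block_le iI); rewrite -lez_nat abszE incE.
apply: (le_trans (ler_norm_sum _ _ _)); rewrite -sum1_card -natz natr_sum.
by apply: ler_sum => j _; case: (f _ _); case: (f _ _).
Qed.

(** A nonzero increment is at most [d < p] in size, so it survives reduction modulo [p]. *)
Lemma inc_neq0_Fp i u : i \in I -> inc i u != 0 -> (inc i u)%:~R != 0 :> 'F_p.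
Proof.
move=> iI e0; have ep : (`|inc i u| < p)%N := leq_ltn_trans (inc_le u iI) d_lt_p.
have e1 : (0 < `|inc i u|)%N by rewrite absz_gt0.
rewrite [inc i u]intEsign rmorphM rmorph_sign mulf_neq0 ?signr_eq0 //=.
rewrite -pmulrn; apply/eqP => /(congr1 (@nat_of_ord _)).
by rewrite val_Fp_nat // modn_small // => e00; rewrite e00 in e1.
Qed.

Definition high (u : bits l) : bool := (N <= #|[set i in I | inc i u != 0%R]|)%N.

(** A flip changes at most the sign of an increment; hence restricting to [high] inputs is
    compatible with averaging over flips. *)
Lemma high_flip i u : i \in I -> high (flip i u) = high u.
Proof.
move=> iI; congr (_ <= _)%N; apply: eq_card => k; rewrite !inE.
case kI: (k \in I) => //=; have [->|ik] := eqVneq i k.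
  by rewrite inc_flip_same oppr_eq0.
by rewrite inc_flip_neq.
Qed.

Definition wrong (z : bits n.+1) : bool :=
  z ord_max != (majmod p (init_bits z) (+) parity (init_bits z)).

(** The weight [c] is the sign of the last output bit on [high] inputs, which no flip in [I]
    changes. Averaging the correct sign over these flips bounds its correlation with [c]. *)
Lemma high_wrong_ge :
  #|[set u | high u]|%:R * ((1 - (p%:R^-1 + eta)) / 2)
    <= #|[set u | high u && wrong (f u)]|%:R :> R.
Proof.
pose c u : R := (high u)%:R * (-1) ^+ (f u ord_max).
have card_pred (P : pred (bits l)) : #|[set u | P u]|%:R = \sum_u (P u)%:R :> R.
  by rewrite -sum1dep_card natr_sum big_mkcond; apply: eq_bigr => u _; case: (P u).
have wrongE u : (high u && wrong (f u))%:R =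
    ((high u)%:R - c u * twist (majmod_sign R p) (weight u)) / 2 :> R.
  rewrite /c /weight twist_majmod_sign // /wrong.
  case: (high u); last by rewrite !mul0r subr0 mul0r.
  rewrite mul1r -signr_addb /=; case: (f u _); case: (_ (+) _) => /=; lra.
rewrite !card_pred (eq_bigr _ (fun u _ => wrongE u)) -mulr_suml sumrB mulrA.
rewrite ler_pM2r ?invr_gt0 // mulrBr mulr1 lerD2l lerN2.
rewrite (@sum_avg_increments _ _ _ _ flip weight c _ _ (enum I)) ?enum_uniq //; first last.
- by move=> i k; rewrite !mem_enum => iI kI ik u; apply: inc_flip_neq.
- by move=> i; rewrite mem_enum => iI u; rewrite /c high_flip // local_flip // I_last.
- by move=> i; apply: flipsK.
rewrite mulr_suml; apply: ler_sum => u _.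
rewrite /c; case hu: (high u); last by rewrite !mul0r.
rewrite !mul1r; apply: (le_trans (ler_norm _)); rewrite normrM normr_sign mul1r norm_twist.
apply: (@avg_shifts_bound _ _ p_pr _ _ N) => //.
- by move=> w; exact: sqrr_sign.
- exact: norm_sum_majmod_sign.
- by move=> _ /mapP[i + ->]; rewrite mem_enum; apply: inc_neq0_Fp.
- apply: leq_trans hu _; rewrite count_map -size_filter cardE.
  rewrite uniq_leq_size ?enum_uniq // => i; rewrite mem_enum inE => /andP[iI ei].
  by rewrite mem_filter mem_enum iI andbT.
Qed.

Let zeros z := zero_blocks I block (init_bits z).

(* A vanishing block whose weight does not change when [i] is flipped is constant in [i]. *)
Lemma flips_constant_blocks (u : bits l) (A : {set 'I_l}) :
  A \subset [set i in zeros (f u) | inc i u == 0] -> f (flips A u) = f u.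
Proof.
move=> AL.
have flip1 i : i \in A -> f (flip i u) = f u.
  move=> /(subsetP AL); rewrite !inE => /andP[/andP[iI /forall_inP zi] /eqP].
  rewrite incE => inc0; apply/ffunP => j.
  have [ij|] := boolP (i \in S j); last exact: local_flip.
  case: (unliftP ord_max j) => [j' jE|jE]; last first.
    by have := I_last iI; rewrite -jE ij.
  have jb : j' \in block i by rewrite inE -jE.
  have zf k : k \in block i -> f u (lift ord_max k) = false.
    by move=> /zi; rewrite ffunE => /negPf.
  rewrite jE zf //; move: inc0; rewrite (eq_bigr (fun k => (f (flip i u) (lift ord_max k))%:R)).
    move/eqP; rewrite psumr_eq0 //= => /allP /(_ j' (mem_index_enum _)).
    by rewrite jb; case: (f _ _).
  by move=> k kb; rewrite zf // subr0.
(* An output bit reads at most one member of [A], so it sees at most a single flip. *)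
apply/ffunP => j; have [AS0|] := eqVneq (A :&: S j) set0.
  apply: f_local => i ij; rewrite ffunE.
  have : i \notin A :&: S j by rewrite AS0 inE.
  by rewrite inE ij andbT => /negPf ->; rewrite addbF.
move=> /set0Pn[i]; rewrite inE => /andP[iA ij].
rewrite -(flip1 i iA); apply: f_local => k kj; rewrite !ffunE inE; congr (_ (+) _).
have AI a : a \in A -> a \in I.
  by move=> /(subsetP AL); rewrite !inE => /andP[/andP[]].
apply/idP/eqP => [kA|->] //; exact: I_disj (AI _ kA) (AI _ iA) kj ij.
Qed.

Definition low_image : {set bits n.+1} :=
  [set z | (K <= #|zeros z|)%N && [exists u, ~~ high u && (f u == z)]].

(** Fewer than [N] of the [K] vanishing blocks have a nonzero increment. The other inputs can be
    flipped in any combination, which gives each such output at least [2 ^ (K - N)] preimages. *)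
Lemma card_low_image : (#|low_image| * 2 ^ (K - N) <= 2 ^ l)%N.
Proof.
have -> : (2 ^ l = \sum_z #|[set u | f u == z]|)%N.
  have -> : (2 ^ l = #|bits l|)%N by rewrite card_ffun card_bool card_ord.
  rewrite -sum1_card (partition_big f predT) //=; apply: eq_bigr => z _.
  by rewrite -sum1dep_card.
rewrite (bigID (mem low_image)) /= -sum_nat_const; apply: leq_trans (leq_addr _ _).
apply: leq_sum => z; rewrite inE => /andP[Kz /existsP[u /andP[hu /eqP fu]]].
pose L := [set i in zeros (f u) | inc i u == 0].
have LK : (K - N <= #|L|)%N.
  rewrite leq_subLR; apply: leq_trans Kz _; rewrite -fu.
  rewrite -(cardsID [set i in I | inc i u != 0]) leq_add //.
    apply: (@leq_trans #|[set i in I | inc i u != 0]|).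
      by rewrite subset_leq_card ?subsetIr.
    by rewrite ltnW // ltnNge.
  apply/subset_leq_card/subsetP => i; rewrite !inE => /andP[+ /andP[iI ->]].
  by rewrite iI negbK.
apply: (@leq_trans #|[set flips A u | A in powerset L]|).
  by rewrite card_imset ?card_powerset ?leq_exp2l //; exact: flips_inj.
apply/subset_leq_card/subsetP => _ /imsetP[A + ->]; rewrite !inE => AL.
by rewrite flips_constant_blocks // fu.
Qed.

Definition distinguisher : {set bits n.+1} :=
  [set z | [|| wrong z, (#|zeros z| < K)%N | z \in low_image]].

(** Inputs that are not [high] always land in the set, through its second or third clause; [high]
    ones are wrong almost half of the time. *)
Lemma push_prob_distinguisher_ge :
  (1 - (p%:R^-1 + eta)) / 2 <= push_prob R f distinguisher.
Proof.
rewrite /push_prob ler_pdivlMr; last by rewrite ltr0n card_ffun card_bool card_ord expn_gt0.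
set a := _ / 2.
have a1 : a <= 1.
  rewrite /a; have : 0 <= p%:R^-1 :> R by rewrite invr_ge0.
  by have := eta_ge0; lra.
have -> : #|bits l| = (#|[set u | high u]| + #|~: [set u | high u]|)%N.
  by rewrite cardsC.
rewrite natrD mulrDr.
apply: (@le_trans _ _ (#|[set u | high u && wrong (f u)]| + #|~: [set u | high u]|)%N%:R).
  rewrite natrD; apply: lerD; first by rewrite mulrC high_wrong_ge.
  by rewrite ler_piMl ?ler0n.
have disj : [disjoint [set u | high u && wrong (f u)] & ~: [set u | high u]].
  by rewrite -setI_eq0; apply/eqP/setP => u; rewrite !inE; case: (high u); rewrite ?andbF.
rewrite ler_nat; have := leq_card_setU [set u | high u && wrong (f u)] (~: [set u | high u]).
rewrite disj => -[_ /eqP <-].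
apply/subset_leq_card/subsetP => u; rewrite !inE => /orP[/andP[_ ->] //|hu].
case: leqP => //= zu; last by rewrite orbT.
by rewrite orbC; apply/orP; left; apply/existsP; exists u; rewrite hu eqxx.
Qed.

(** The target is never wrong, rarely has few vanishing blocks, and meets [low_image] at most once
    per element because it is injective. *)
Lemma push_prob_target_distinguisher_le :
  (0 < K)%N -> K.*2%:R <= \sum_(i in I) 2 ^- #|block i| :> R ->
  push_prob R (target_map p (n := n)) distinguisher <=
    2 / K%:R + 2 ^+ l / 2 ^+ (K - N) / 2 ^+ n.
Proof.
move=> K0 KE; rewrite /push_prob card_ffun card_bool card_ord natrX.
rewrite ler_pdivrMr ?exprn_gt0 // mulrDl divfK ?expf_neq0 ?pnatr_eq0 //.
pose Z := [set x | #|zero_blocks I block x| < K]%N.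
pose J := [set x | target_map p x \in low_image].
apply: (@le_trans _ _ (#|Z| + #|J|)%N%:R).
  rewrite ler_nat; apply: leq_trans (leq_card_setU _ _); apply/subset_leq_card/subsetP => x.
  rewrite inE in_setU [x \in Z]inE [x \in J]inE [_ \in distinguisher]inE.
  by rewrite /wrong /zeros /target_map init_snoc_bit snoc_bit_last eqxx.
rewrite natrD; apply: lerD.
  by rewrite mulrC card_few_zero_blocks //; exact: block_disj.
rewrite ler_pdivlMr ?exprn_gt0 // -!natrX -natrM ler_nat.
apply: leq_trans card_low_image; rewrite leq_mul2r; apply/orP; right.
rewrite -(card_imset J (f := target_map p (n := n))); last first.
  by move=> x y /(congr1 (@init_bits n)); rewrite !init_snoc_bit.
by apply/subset_leq_card/subsetP => _ /imsetP[x + ->]; rewrite inE.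
Qed.

End LocalMap.

(** * Lower bounds on the total variation distance *)

Lemma tv_push_ge (R : realType) (A1 A2 B : finType) (g1 : A1 -> B) (g2 : A2 -> B) (T : {set B}) :
  push_prob R g1 T - push_prob R g2 T <= tv_push R g1 g2.
Proof.
apply: (le_trans (ler_norm _)); rewrite /tv_push.
exact: (le_bigmax _ (fun T => `|push_prob R g1 T - push_prob R g2 T|)).
Qed.

(** Test with the image of [f]: the injective target hits it with probability at most
    [2 ^ l / 2 ^ n]. *)
Lemma tv_push_short_seed (R : realType) (l n p : nat) (f : bits l -> bits n.+1) :
  (l < n)%N -> 1 / 2 <= tv_push R f (target_map p (n := n)).
Proof.
move=> ln; apply: le_trans (tv_push_ge R f _ [set f u | u in [set: bits l]]).
have cardb k : #|bits k|%:R = 2 ^+ k :> R.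
  by rewrite card_ffun card_bool card_ord natrX.
rewrite /push_prob !cardb.
have -> : [set a | f a \in [set f u | u in [set: bits l]]] = setT.
  by apply/setP => u; rewrite !inE imset_f ?inE.
rewrite cardsT cardb divff ?expf_neq0 ?pnatr_eq0 //.
suff : #|[set a | target_map p a \in [set f u | u in [set: bits l]]]|%:R / 2 ^+ n <= 1 / 2 :> R by lra.
rewrite ler_pdivrMr ?exprn_gt0 //.
apply: (@le_trans _ _ (2 ^+ l)).
  rewrite -cardb ler_nat -cardsT; apply: leq_trans (leq_imset_card f _).
  rewrite -(card_imset _ (f := target_map p (n := n))); last first.
    by move=> x y /(congr1 (@init_bits n)); rewrite !init_snoc_bit.
  by apply/subset_leq_card/subsetP => _ /imsetP[x + ->]; rewrite inE.
rewrite mul1r ler_pdivlMl // -exprS ler_weXn2l //; lra.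
Qed.

(** * Choice of the parameters *)

Lemma tv_push_local_ge (R : realType) (l n d p N K : nat) (f : bits l -> bits n.+1)
    (S : 'I_n.+1 -> {set 'I_l}) (eta : R) :
  (forall j (x y : bits l), (forall i, i \in S j -> x i = y i) -> f x j = f y j) ->
  (forall j, #|S j| <= d)%N -> (0 < d)%N -> prime p -> (4 * d < p)%N ->
  0 <= eta -> contraction R p ^+ N * p%:R <= eta ^+ 2 ->
  (0 < K)%N -> (n <= l)%N -> (4 * K * 2 ^ (4 * d) * (4 * d ^ 2 + 1) <= n)%N ->
  (1 - (p%:R^-1 + eta)) / 2 - (2 / K%:R + 2 ^+ l / 2 ^+ (K - N) / 2 ^+ n)
    <= tv_push R f (target_map p (n := n)).
Proof.
move=> f_local Sd d0 p_pr dp eta0 eta_p K0 nl nK.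
have p_odd : odd p by case: (even_prime p_pr) => // p2; move: dp; rewrite p2; lia.
have [I [I_last I_disj I_deg I_card]] := exists_independent_inputs Sd d0.
(* As [4 * d + 1 <= n <= l], the count for [I] gives [n <= 2 * #|I| * (4 * d ^ 2 + 1)]. *)
have I_ge : (K.*2 * 2 ^ (4 * d) <= #|I|)%N.
  have e4d : (4 * d < 2 ^ (4 * d))%N by apply: ltn_expl.
  have n4d : (4 * d + 1 <= n)%N.
    apply: leq_trans nK; apply: (@leq_trans (2 ^ (4 * d))); first by rewrite addn1.
    by rewrite -[leqLHS]muln1 leq_mul ?addn1 // leq_pmull // muln_gt0.
  have a0 : (0 < 4 * d ^ 2 + 1)%N by rewrite addn1.
  rewrite -(leq_pmul2r a0).
  move: nK I_card n4d nl.
  move: (2 ^ (4 * d))%N (4 * d ^ 2 + 1)%N => a b; rewrite -muln2 => *; nia.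
apply: le_trans (tv_push_ge R f (target_map p (n := n)) (distinguisher p N K f S I)).
apply: lerB.
  by apply: (@push_prob_distinguisher_ge _ _ _ (4 * d)%N).
apply: push_prob_target_distinguisher_le => //.
apply: (@le_trans _ _ (#|I|%:R * 2 ^- (4 * d))).
  by rewrite ler_pdivlMr ?exprn_gt0 // -natrX -natrM ler_nat.
rewrite mulr_natl -sumr_const; apply: ler_sum => i iI.
rewrite lef_pV2 ?posrE ?exprn_gt0 // ler_weXn2l ?ler1n //.
exact: card_block_le I_deg i iI.
Qed.

(** With [h = g / 4], the exponential dominates [(h * L) ^ 4], which beats the cube once
    [L >= C / h ^ 4]. *)
Lemma cube_le_expR (R : realType) (g C : R) : 0 < g -> 0 < C ->
  exists2 L0, 1 <= L0 & forall L, L0 <= L -> C * L ^+ 3 <= expR (g * L).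
Proof.
move=> g0 C0; pose h := g / 4; have h0 : 0 < h by rewrite divr_gt0.
exists (1 + C / h ^+ 4) => [|L LL].
  by rewrite lerDl divr_ge0 ?exprn_ge0 ?ltW.
have h4 : 0 < h ^+ 4 by rewrite exprn_gt0.
have L0 : 0 <= L by apply: le_trans LL; rewrite addr_ge0 ?divr_ge0 ?ltW.
have -> : g * L = 4%:R * (h * L) by rewrite /h; field.
rewrite expRM_natl.
apply: (@le_trans _ _ ((h * L) ^+ 4)).
  rewrite exprMn (exprS L 3) [h ^+ 4 * _]mulrA ler_wpM2r ?exprn_ge0 //.
  rewrite -ler_pdivrMl // mulrC; apply: le_trans LL; rewrite lerDr; lra.
have hL0 : 0 <= h * L by rewrite mulr_ge0 // ltW.
rewrite lerXn2r ?nnegrE ?expR_ge0 //.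
by apply: le_trans (expR_ge1Dx _); rewrite lerDr.
Qed.

Lemma contraction_exp_le (R : realType) (p N : nat) (L : R) : prime p ->
  6 * p%:R ^+ 2 * L <= N%:R -> contraction R p ^+ N <= expR (- (3 * L)).
Proof.
move=> p_pr NL.
have p0 : 0 < p%:R ^+ 2 :> R by rewrite exprn_gt0 // ltr0n prime_gt0.
apply: (@le_trans _ _ (expR (- (2 * p%:R ^+ 2)^-1) ^+ N)).
  rewrite lerXn2r ?nnegrE ?contraction_ge0 ?expR_ge0 //; exact: expR_ge1Dx.
rewrite -expRM_natl ler_expR mulrN lerN2 ler_pdivlMr; lra.
Qed.

(** Bounds the future [K]: [theta] dominates both [2 * alpha], from [P ^ 2], and [delta], from the
    seed excess [M]. *)
Lemma threshold_le (R : realType) (alpha delta theta c L P N M Q : R) :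
  1 <= L -> 0 < c -> 0 <= P -> alpha < 1 / 3 -> 2 / 3 <= theta -> delta <= theta ->
  P <= c * expR (alpha * L) -> N <= 6 * P ^+ 2 * L + 1 -> M <= expR (delta * L) ->
  Q <= L + 1 -> N + (M + Q) <= (6 * c ^+ 2 + 4) * L * expR (theta * L).
Proof.
move=> L1 c0 P0 alpha13 theta23 delta_theta P_le N_le M_le Q_le.
have L0 : 0 <= L := le_trans ler01 L1.
have P2 : P ^+ 2 <= c ^+ 2 * expR (theta * L).
  apply: (@le_trans _ _ ((c * expR (alpha * L)) ^+ 2)).
    by rewrite lerXn2r ?nnegrE ?mulr_ge0 ?expR_ge0 ?(ltW c0).
  rewrite exprMn ler_wpM2l ?sqr_ge0 // -expRM_natl ler_expR mulrA ler_wpM2r //.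
  by clear -alpha13 theta23; lra.
have M_theta : M <= expR (theta * L) by apply: le_trans M_le _; rewrite ler_expR ler_wpM2r.
have {P2} P2L := ler_wpM2r L0 P2.
have E1 : 1 <= expR (theta * L).
  by rewrite -expR0 ler_expR mulr_ge0 //; apply: le_trans theta23; rewrite divr_ge0.
have LE : L <= L * expR (theta * L) by rewrite ler_peMr.
have EL : expR (theta * L) <= L * expR (theta * L) by rewrite ler_peMl // expR_ge0.
have -> : (6 * c ^+ 2 + 4) * L * expR (theta * L) =
  6 * (c ^+ 2 * expR (theta * L) * L) + 4 * (L * expR (theta * L)) by ring.
by clear -P2L M_theta E1 LE EL N_le Q_le; lra.
Qed.

Lemma pow2_le_expR (R : realType) (t : nat) (x : R) :
  t%:R <= x -> 2 ^+ (4 * t.+1) <= 16 * expR (4 * x).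
Proof.
move=> tx; rewrite mulnS exprD; have -> : 2 ^+ 4 = 16 :> R by ring.
rewrite ler_pM2l //; apply: (@le_trans _ _ (expR 1 ^+ (4 * t))).
  by rewrite lerXn2r ?nnegrE ?expR_ge0 //; apply: le_trans (expR_ge1Dx _).
by rewrite -expRM_natl mulr1 ler_expR natrM ler_pM2l.
Qed.

(** [M] absorbs the excess of [l] over [n], and the remaining factor [2 ^ Q] exceeds [L]. *)
Lemma seed_excess_le (R : realType) (l n M Q : nat) (L : R) : 0 < L ->
  (l <= n + M)%N -> L <= Q%:R -> 2 ^+ l / 2 ^+ (M + Q) / 2 ^+ n <= L^-1.
Proof.
move=> L0 lnM LQ.
rewrite ler_pdivrMr ?exprn_gt0 // ler_pdivrMr ?exprn_gt0 // -mulrA -exprD.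
apply: (@le_trans _ _ (2 ^+ (n + M))); first by rewrite ler_weXn2l // ler1n.
rewrite addnA (exprD _ (n + M)) mulrCA ler_peMr ?exprn_ge0 // mulrC ler_pdivlMr ?mul1r //.
by apply: (le_trans LQ); rewrite -natrX ler_nat ltnW // ltn_expl.
Qed.

Theorem theorem5p1 (R : realType) (delta alpha : R) :
  0 <= delta -> delta < 1 -> delta / 3 < alpha -> alpha < 1 / 3 ->
  exists eps : R, 0 < eps /\
  forall c1 c2 : R, 0 < c1 -> c1 <= c2 ->
  exists C : R, 0 < C /\ exists n0 : nat,
  forall n : nat, (n0 <= n)%N ->
  forall p : nat, prime p ->
    c1 * (n%:R `^ alpha) <= p%:R -> p%:R <= c2 * (n%:R `^ alpha) ->
  forall l : nat, l%:R <= n%:R + n%:R `^ delta ->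
  forall f : bits l -> bits n.+1,
    is_local (eps * ln (n%:R : R)) f ->
    1 / 2 - C / ln (n%:R : R) <= tv_push R f (target_map p (n:=n)).
Proof.
move=> delta0 delta1 delta_alpha alpha13.
have alpha0 : 0 < alpha by lra.
have [theta [theta1 theta23 theta_delta]] :
    exists theta : R, [/\ theta < 1, 2 / 3 <= theta & delta <= theta].
  by exists (Num.max (2 / 3) delta); rewrite gt_max delta1 !le_max !lexx orbT; split=> //; lra.
(* Then [expR (4 * eps * L)] uses half of the gap between [n ^ theta] and [n]; the other half
   absorbs powers of [L]. *)
pose eps := (1 - theta) / 8.
have eps0 : 0 < eps by rewrite /eps; lra.
have eps1 : eps <= 1 by rewrite /eps; lra.
exists eps; split=> //.
move=> c1 c2 c10 c12; have c20 : 0 < c2 := lt_le_trans c10 c12.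
(* The errors are [1 / L] from [p] and [eta] together, [2 / L] from Chebyshev and [1 / L] from
   [low_image]. *)
exists 4; split=> //.
(* The three growth bounds give [9 * L <= p], then [p <= n], then the size condition on [n], where
   1088 is [4 * 16 * 17]. *)
have [L1 L1_ge1 growth1] := @cube_le_expR R alpha (9 / c1) alpha0 ltac:(by rewrite divr_gt0).
have [L2 L2_ge1 growth2] := @cube_le_expR R (1 - alpha) c2 ltac:(lra) c20.
have [L3 L3_ge1 growth3] := @cube_le_expR R ((1 - theta) / 2) (1088 * (6 * c2 ^+ 2 + 4))
  ltac:(lra) ltac:(nra).
exists (Num.trunc (expR (L1 + L2 + L3))).+1 => n n_ge p p_pr p_ge p_le l l_le f f_loc.
have {}n_ge : expR (L1 + L2 + L3) <= n%:R.
  by apply: (le_trans (ltW (truncnS_gt _))); rewrite ler_nat.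
have n0 : 0 < n%:R :> R by apply: lt_le_trans n_ge; exact: expR_gt0.
set L := ln (n%:R : R) in f_loc *.
have nE : n%:R = expR L by rewrite lnK ?posrE.
have [L_L1 L_L2 L_L3] : [/\ L1 <= L, L2 <= L & L3 <= L].
  have : L1 + L2 + L3 <= L by rewrite -ler_expR -nE.
  by clear -L1_ge1 L2_ge1 L3_ge1 => *; split; lra.
have L_ge1 : 1 <= L := le_trans L1_ge1 L_L1.
have L_gt0 : 0 < L := lt_le_trans ltr01 L_ge1.
have L_ge0 := ltW L_gt0.
have powE a : n%:R `^ a = expR (a * L) by rewrite /powR gt_eqF.
rewrite !powE in p_ge p_le l_le.
clearbody L => {powE n_ge}.
have [ln_lt|nl] := ltnP l n.
  by apply: le_trans (tv_push_short_seed R p f ln_lt); rewrite gerBl divr_ge0.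
have p_L : 9 * L <= p%:R.
  apply: le_trans p_ge; have := growth1 L L_L1.
  rewrite mulrAC ler_pdivrMr // [leRHS]mulrC.
  by apply: le_trans; rewrite ler_pM2l // ler_eXnr.
have pn : p%:R <= n%:R :> R.
  apply: (le_trans p_le); rewrite nE.
  have -> : expR L = expR ((1 - alpha) * L) * expR (alpha * L).
    by rewrite -expRD; congr expR; ring.
  rewrite ler_wpM2r ?expR_ge0 //; apply: le_trans (growth2 L L_L2).
  by rewrite ler_peMr ?(ltW c20) // exprn_ege1.
have {growth1 growth2 L_L1 L_L2} growth := growth3 L L_L3.
have [S S_loc] := fin_all_exists f_loc.
have truncD (x : R) : 0 <= x -> (Num.trunc x)%:R <= x by rewrite -truncn_le.
have epsL0 : 0 <= eps * L by rewrite mulr_ge0 // ltW.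
have [t t_le t_gt] : exists2 t : nat, t%:R <= eps * L & eps * L < t.+1%:R.
  by exists (Num.trunc (eps * L)); rewrite ?truncD ?truncnS_gt.
have [N N_ge N_le] : exists2 N : nat, 6 * p%:R ^+ 2 * L <= N%:R & N%:R <= 6 * p%:R ^+ 2 * L + 1.
  exists (Num.trunc (6 * p%:R ^+ 2 * L)).+1; first exact: ltW (truncnS_gt _).
  by rewrite -[leLHS]natr1 lerD2r truncD // !mulr_ge0 ?sqr_ge0.
have [M M_le M_ge] : exists2 M : nat, M%:R <= expR (delta * L) & (l <= n + M)%N.
  exists (Num.trunc (expR (delta * L))); first by rewrite truncD ?expR_ge0.
  by rewrite -leq_subLR truncn_ge_nat ?expR_ge0 // natrB // lerBlDl.
have [Q Q_ge Q_le] : exists2 Q : nat, L <= Q%:R & Q%:R <= L + 1.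
  exists (Num.trunc L).+1; first exact: ltW (truncnS_gt _).
  by rewrite -[leLHS]natr1 lerD2r truncD.
have d_le : t.+1%:R <= 2 * L.
  have : eps * L <= L by rewrite ler_piMl.
  by rewrite -[t.+1%:R]natr1; clear -t_le L_ge1 => *; lra.
have Sd j : (#|S j| <= t.+1)%N.
  by rewrite -(ler_nat R) (le_trans (S_loc j).1) // ltW.
(* [N] serves the contraction, [M] the seed excess, and [Q] makes the remaining loss at most
   [1 / L]. *)
pose K := (N + (M + Q))%N.
have K_L : L <= K%:R.
  by apply: (le_trans Q_ge); rewrite ler_nat /K addnA leq_addl.
have K_gt0 : (0 < K)%N by rewrite -(ltr_nat R) (lt_le_trans L_gt0).
have p_gt0 : 0 < p%:R :> R by rewrite ltr0n prime_gt0.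
have := @tv_push_local_ge R l n t.+1 p N K f S L^-1.
rewrite addKn => H; apply: le_trans (H _ _ _ _ _ _ _ _ _ _) => {H} //.
- have pL : L <= p%:R by apply: le_trans p_L; rewrite ler_peMl // ler1n.
  have : p%:R^-1 <= L^-1 by rewrite lef_pV2 ?posrE.
  have : K%:R^-1 <= L^-1 by rewrite lef_pV2 ?posrE ?ltr0n.
  have := seed_excess_le L_gt0 M_ge Q_ge.
  move: (_ / _ / _) (K%:R^-1) (p%:R^-1) (L^-1); clear => *; lra.
- by move=> j; exact: (S_loc j).2.
- by rewrite -(ltr_nat R) natrM; clear -d_le p_L L_gt0; lra.
- by rewrite invr_ge0.
- have NL := contraction_exp_le p_pr N_ge.
  apply: (@le_trans _ _ (expR (- (3 * L)) * n%:R)).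
    by apply: ler_pM => //; rewrite exprn_ge0 // contraction_ge0.
  (* Here [expR (- (3 * L)) * n] is [n ^ (-2)], at most [eta ^ 2] for [eta = 1 / L]. *)
  have -> : - (3 * L) = - (L + L + L) by ring.
  rewrite expRN !expRD -nE !invfM mulfVK ?gt_eqF // -expr2.
  rewrite lerXn2r ?nnegrE ?invr_ge0 ?ler0n // lef_pV2 ?posrE //.
  by rewrite nE; apply: le_trans (expR_ge1Dx _); rewrite lerDr.
have K_le : K%:R <= (6 * c2 ^+ 2 + 4) * L * expR (theta * L).
  by rewrite !natrD; exact: threshold_le p_le N_le M_le Q_le.
have two_le := pow2_le_expR t_le.
have d2_le : 4 * t.+1%:R ^+ 2 + 1 <= 17 * L ^+ 2 :> R.
  have : t.+1%:R ^+ 2 <= (2 * L) ^+ 2 by rewrite lerXn2r ?nnegrE ?ler0n ?mulr_ge0.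
  have : 1 <= L ^+ 2 by rewrite exprn_ege1.
  by rewrite exprMn; move: (_ ^+ 2) (L ^+ 2); clear => *; lra.
rewrite -(ler_nat R) !natrM natrD natrM !natrX.
apply: (@le_trans _ _ (4 * ((6 * c2 ^+ 2 + 4) * L * expR (theta * L)) *
    (16 * expR (4 * (eps * L))) * (17 * L ^+ 2))).
  apply: ler_pM => //; last 1 first.
  - by apply: ler_pM => //; rewrite ?mulr_ge0 ?exprn_ge0 ?ler_pM2l.
  - by rewrite !mulr_ge0 ?exprn_ge0.
  by rewrite addr_ge0 ?mulr_ge0 ?sqr_ge0.
have -> : 4 * ((6 * c2 ^+ 2 + 4) * L * expR (theta * L)) * (16 * expR (4 * (eps * L))) *
    (17 * L ^+ 2) =
  1088 * (6 * c2 ^+ 2 + 4) * L ^+ 3 * expR (theta * L) * expR (4 * (eps * L)) by ring.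
rewrite nE; have -> : expR L = expR ((1 - theta) / 2 * L) * expR (theta * L) * expR (4 * (eps * L)).
  by rewrite -!expRD; congr expR; rewrite /eps; field.
by rewrite !ler_wpM2r ?expR_ge0.
Qed.
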